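(* Let $(X,\|\cdot\|)$ be a nonzero normed space, let $n\ge 1$ be an integer and let $0<p\leq 1$. Then the following hold: (i) $G(p;k)=\varnothing$ for all integers $k$ with $0\le k\le n-2$; (ii) $G(p;n-1)$ is the set of all $(\mu_1,\dots,\mu_n)\in\mathbb{R}^n$ for which there exists $j\in\{1,\dots,n\}$ such that $\mu_j>0$, $\mu_i<0$ for all $i\neq j$, and $\mu_j$ is at least the maximum of the number $1$ and the numbers $|\mu_i|$, $i\in\{1,\dots,n\}\setminus\{j\}$; (iii) $G(p;n)=\mathbb{R}^-\times\cdots\times\mathbb{R}^-$ ($n$ factors), where $\mathbb{R}^-=\{t\in\mathbb{R}: t<0\}$; (iv) $G(p)=G(p;n-1)\cup G(p;n)$.
   Context: For a normed space $(X,\|\cdot\|)$, an integer $n\ge1$ and $p>0$, let $G(p)$ be the set of all $n$-tuples $(\mu_1,\dots,\mu_n)\in\mathbb{R}^n$ (with all $\mu_i\neq 0$, so that the fractions make sense) such that $$\left\|\sum_{i=1}^n x_i\right\|^p\geq\sum_{i=1}^n\frac{\|x_i\|^p}{\mu_i}\quad\text{for all } x_1,\dots,x_n\in X.$$ For $k=0,1,\dots,n$, let $G(p;k)$ be the subset of those $(\mu_1,\dots,\mu_n)\in G(p)$ for which exactly $k$ of the numbers $\mu_1,\dots,\mu_n$ are negative. *)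

(* Defs.v *)
From HB Require Import structures.
From mathcomp Require Import all_boot all_order all_algebra.
From mathcomp Require Import all_classical all_reals all_analysis.
Set Implicit Arguments. Unset Strict Implicit. Unset Printing Implicit Defensive.
Import Order.TTheory GRing.Theory Num.Theory.
Import numFieldNormedType.Exports.
Local Open Scope classical_set_scope.
Local Open Scope ring_scope.

(* The n-tuple (mu_1, ..., mu_n) is the row vector mu, with mu_i = mu 0 i for
   i : 'I_n. The powers are real powers; powR maps 0 to 0 when p > 0. *)
Definition G (R : realType) (X : normedModType R) (n : nat) (p : R) :
    set 'rV[R]_n :=
  [set mu | (forall i, mu 0 i != 0) /\
    forall x : 'I_n -> X,
      `|\sum_(i < n) x i| `^ p >= \sum_(i < n) `|x i| `^ p / mu 0 i].

Definition Gneg (R : realType) (X : normedModType R) (n : nat) (p : R)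
    (k : nat) : set 'rV[R]_n :=
  [set mu | G X p mu /\ #|[pred i | mu 0 i < 0]| = k].

(* Main.v *)
Require Import Defs.
From HB Require Import structures.
From mathcomp Require Import all_boot all_order all_algebra.
From mathcomp Require Import all_classical all_reals all_analysis.
Set Implicit Arguments. Unset Strict Implicit. Unset Printing Implicit Defensive.
Import Order.TTheory GRing.Theory Num.Theory.
Import numFieldNormedType.Exports.
Local Open Scope classical_set_scope.
Local Open Scope ring_scope.

(** Everything follows from testing the inequality on tuples with one or two
    nonzero entries, together with the fact that [t |-> t ^ p] is subadditive
    when [0 < p <= 1].

    Necessity. The tuple equal to [v] at [i], to [- v] at [j] and to [0]
    elsewhere has sum [0], so that [1 / mu_i + 1 / mu_j <= 0] whenever
    [i != j] ([G_pair]). Two of the [mu_i] therefore cannot both be positive,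
    and if [mu_j > 0] then [mu_j >= |mu_i|] for the other [i]. The tuple whose
    only nonzero entry is at [j] gives [mu_j >= 1] ([G_single]).

    Sufficiency. If all [mu_i] are negative, the right-hand side is
    nonpositive. If [mu_j] is the only positive one and dominates [1] and the
    [|mu_i|], write [x_j] as the total sum minus the other entries:
    subadditivity gives [|x_j| ^ p <= |sum x| ^ p + sum_(i != j) |x_i| ^ p],
    and after division by [mu_j] the coefficients on the right are at most [1]
    and [1 / |mu_i|] ([G_of_dominant]).

    Hence an element of [G] either has all entries negative or is dominated by
    a single positive entry ([G_cases]); these two shapes have exactly [n] and
    [n - 1] negative entries, and the four claims are read off by counting. *)

(** Concavity enters through homogeneity only: with [s = a + b] the ratio
    [a / s] lies in the unit interval, where [t <= t ^ p], and the two ratios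
    add up to [1]. *)
Lemma powR_subadditive (R : realType) (p a b : R) :
  0 < p -> p <= 1 -> 0 <= a -> 0 <= b -> (a + b) `^ p <= a `^ p + b `^ p.
Proof.
move=> p0 p1 a0 b0.
have [->|an0] := eqVneq a 0; first by rewrite add0r lerDr powR_ge0.
have s0 : 0 < a + b by rewrite ltr_wpDr // lt_def an0.
have ratio c : 0 <= c -> c <= a + b -> (a + b) `^ p * (c / (a + b)) <= c `^ p.
  move=> c0 cs; have [->|cn0] := eqVneq c 0.
    by rewrite mul0r mulr0 powR_ge0.
  have cgt0 : 0 < c by rewrite lt_def cn0.
  have q01 : 0 < c / (a + b) <= 1.
    by rewrite divr_gt0 //= ler_pdivrMr // mul1r.
  have -> : c `^ p = (a + b) `^ p * (c / (a + b)) `^ p.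
    by rewrite -powRM ?divr_ge0 ?(ltW s0) // mulrC divfK ?gt_eqF.
  rewrite ler_wpM2l ?powR_ge0 // -[leLHS]powRr1; last by case/andP: q01 => /ltW.
  exact: ger_powR.
apply: le_trans (lerD (ratio a a0 _) (ratio b b0 _)); rewrite ?lerDl ?lerDr //.
by rewrite -mulrDr -mulrDl divff ?gt_eqF // mulr1.
Qed.

Lemma powR_normD (R : realType) (X : normedModType R) (p : R) (x y : X) :
  0 < p -> p <= 1 -> `|x + y| `^ p <= `|x| `^ p + `|y| `^ p.
Proof.
move=> p0 p1; apply: le_trans (powR_subadditive p0 p1 _ _) => //.
by rewrite ge0_ler_powR ?nnegrE ?addr_ge0 ?ler_normD // ltW.
Qed.

Lemma powR_norm_sum (R : realType) (X : normedModType R) (p : R) (I : Type)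
    (r : seq I) (P : pred I) (x : I -> X) :
  0 < p -> p <= 1 ->
  `|\sum_(i <- r | P i) x i| `^ p <= \sum_(i <- r | P i) `|x i| `^ p.
Proof.
move=> p0 p1; apply: (big_ind2 (fun (u : X) (s : R) => `|u| `^ p <= s)) => //.
  by rewrite normr0 powR0 // gt_eqF.
by move=> u s v t us vt; apply: le_trans (powR_normD u v p0 p1) (lerD us vt).
Qed.

Lemma G_single (R : realType) (X : normedModType R) (n : nat) (p : R)
    (mu : 'rV[R]_n) (j : 'I_n) :
  (exists x : X, x != 0) -> 0 < p -> G X p mu -> 0 < mu 0 j -> 1 <= mu 0 j.
Proof.
move=> [v v0] p0 [_ Gmu] mj0.
have vp : 0 < `|v| `^ p by rewrite powR_gt0 ?normr_gt0.
have := Gmu (fun k => if k == j then v else 0).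
rewrite -big_mkcond big_pred1_eq (bigD1 j) //= eqxx big1 ?addr0 => [|k /negPf->].
  by rewrite ler_pdivrMr // ler_pMr.
by rewrite normr0 powR0 ?gt_eqF // mul0r.
Qed.

(** Opposite vectors in two slots make the left-hand side vanish. *)
Lemma G_pair (R : realType) (X : normedModType R) (n : nat) (p : R)
    (mu : 'rV[R]_n) (i j : 'I_n) :
  (exists x : X, x != 0) -> 0 < p -> G X p mu -> i != j ->
  (mu 0 i)^-1 + (mu 0 j)^-1 <= 0.
Proof.
move=> [v v0] p0 [_ Gmu] ij; have ji : j != i by rewrite eq_sym.
have vp : 0 < `|v| `^ p by rewrite powR_gt0 ?normr_gt0.
pose x k : X := if k == i then v else if k == j then - v else 0.
have x0 k : (k != i) && (k != j) -> x k = 0.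
  by rewrite /x => /andP[/negPf-> /negPf->].
have xi : x i = v by rewrite /x eqxx.
have xj : x j = - v by rewrite /x (negPf ji) eqxx.
have := Gmu x.
rewrite (bigD1 i) //= (bigD1 j) //= big1 => [|k kij]; last first.
  by rewrite x0 // normr0 powR0 ?gt_eqF // mul0r.
rewrite [in leRHS](bigD1 i) //= [in leRHS](bigD1 j) //= [in leRHS]big1 //.
rewrite xi xj normrN !addr0 subrr normr0 powR0 ?gt_eqF //.
by rewrite -mulrDr pmulr_rle0.
Qed.

(** By [G_pair] a positive entry forces all the others to be negative, since a
    sum of two positive inverses is positive. *)
Lemma G_cases (R : realType) (X : normedModType R) (n : nat) (p : R)
    (mu : 'rV[R]_n) :
  (exists x : X, x != 0) -> 0 < p -> G X p mu ->
  (forall i, mu 0 i < 0) \/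
  exists j : 'I_n,
    [/\ 0 < mu 0 j,
        forall i, i != j -> mu 0 i < 0 &
        \big[Num.max/1]_(i < n | i != j) `|mu 0 i| <= mu 0 j].
Proof.
move=> hX p0 Gmu; have [mu_neq0 _] := Gmu.
have [/existsP[j mj0]|/existsPn nopos] := boolP [exists j, 0 < mu 0 j].
  right; exists j.
  have neg i : i != j -> mu 0 i < 0.
    move=> ij; rewrite ltNge; apply: contraTN (G_pair hX p0 Gmu ij) => mi0.
    by rewrite -ltNge ltr_wpDl ?invr_gt0 ?invr_ge0.
  split=> //; apply: bigmax_le => [|i ij]; first exact: (G_single hX p0 Gmu).
  have mi0 := neg i ij.
  rewrite ltr0_norm // -lef_pV2 ?posrE ?oppr_gt0 //.
  by rewrite invrN -subr_le0 opprK addrC (G_pair hX p0 Gmu).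
by left=> i; rewrite lt_neqAle mu_neq0 leNgt nopos.
Qed.

Lemma G_of_neg (R : realType) (X : normedModType R) (n : nat) (p : R)
    (mu : 'rV[R]_n) :
  (forall i, mu 0 i < 0) -> G X p mu.
Proof.
move=> neg; split=> [i|x]; first by rewrite lt_eqF.
apply: le_trans (powR_ge0 _ _); apply: sumr_le0 => i _.
by rewrite mulr_ge0_le0 ?powR_ge0 // invr_le0 ltW.
Qed.

(** Isolating the one positive term [|x_j| ^ p / mu_j], it is enough to bound
    [|x_j| ^ p] by the triangle inequality for [t ^ p] applied to
    [x_j = S - sum_(i != j) x_i]; the condition on [mu_j] is what lets
    [1 / mu_j] be replaced by [1] and by [- 1 / mu_i]. *)
Lemma G_of_dominant (R : realType) (X : normedModType R) (n : nat) (p : R)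
    (mu : 'rV[R]_n) (j : 'I_n) :
  0 < p -> p <= 1 -> 0 < mu 0 j -> (forall i, i != j -> mu 0 i < 0) ->
  \big[Num.max/1]_(i < n | i != j) `|mu 0 i| <= mu 0 j -> G X p mu.
Proof.
move=> p0 p1 mj0 neg /bigmax_leP[mj1 dom].
split=> [i|x].
  by have [->|/neg] := eqVneq i j; [rewrite gt_eqF|move/lt_eqF->].
set S := \sum_(i < n) x i.
have xjE : x j = S + \sum_(i < n | i != j) - x i.
  by rewrite /S (bigD1 j) //= sumrN addrK.
have xj_le : `|x j| `^ p <= `|S| `^ p + \sum_(i < n | i != j) `|x i| `^ p.
  rewrite xjE; apply: le_trans (powR_normD _ _ p0 p1) _.
  rewrite lerD2l; apply: le_trans (powR_norm_sum _ _ _ p0 p1) _.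
  by under eq_bigr do rewrite normrN.
rewrite (bigD1 j) //= -lerBrDr -sumrN.
apply: (@le_trans _ _
    ((`|S| `^ p + \sum_(i < n | i != j) `|x i| `^ p) / mu 0 j)).
  by rewrite ler_pM2r ?invr_gt0.
rewrite mulrDl mulr_suml lerD //.
  by rewrite ler_pdivrMr // ler_peMr ?powR_ge0.
apply: ler_sum => i ij; have mi0 := neg i ij.
rewrite -mulrN -invrN ler_wpM2l ?powR_ge0 //.
by rewrite lef_pV2 ?posrE ?oppr_gt0 // -ltr0_norm // dom.
Qed.

Lemma card_neg_all (R : realType) (n : nat) (mu : 'rV[R]_n) :
  (forall i, mu 0 i < 0) -> #|[pred i | mu 0 i < 0]| = n.
Proof.
by move=> neg; rewrite -[RHS]card_ord; apply: eq_card => i; rewrite !inE neg.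
Qed.

Lemma card_neg_all_but_one (R : realType) (n : nat) (mu : 'rV[R]_n)
    (j : 'I_n) :
  0 < mu 0 j -> (forall i, i != j -> mu 0 i < 0) ->
  #|[pred i | mu 0 i < 0]| = n.-1.
Proof.
move=> mj0 neg; rewrite -[in RHS](card_ord n) -(cardC1 j).
apply: eq_card => i; rewrite !inE.
by have [->|/neg] := eqVneq i j; first by rewrite ltNge ltW.
Qed.

Theorem theorem2p7 (R : realType) (X : normedModType R)
    (hX : exists x : X, x != 0) (n : nat) (hn : (1 <= n)%N)
    (p : R) (hp0 : 0 < p) (hp1 : p <= 1) :
  (forall k : nat, (k + 2 <= n)%N -> Gneg X p k = set0 :> set 'rV[R]_n) /\
  Gneg X p n.-1 =
    [set mu : 'rV[R]_n | exists j : 'I_n,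
       [/\ 0 < mu 0 j,
           forall i, i != j -> mu 0 i < 0 &
           \big[Num.max/1]_(i < n | i != j) `|mu 0 i| <= mu 0 j]] /\
  Gneg X p n = [set mu : 'rV[R]_n | forall i, mu 0 i < 0] /\
  G X p = Gneg X p n.-1 `|` Gneg X p n :> set 'rV[R]_n.
Proof.
have pred_neq : n.-1 <> n by case: n hn => //= m _ /eqP; rewrite ltn_eqF.
split; [|split; [|split]].
- move=> k kn; apply/seteqP; split=> mu //= -[Gmu].
  have [neg|[j [mj0 neg _]]] := G_cases hX hp0 Gmu.
    by rewrite card_neg_all // => nk; move: kn; rewrite -nk addn2 ltnNge leqnSn.
  rewrite (card_neg_all_but_one mj0 neg) => nk.
  by move: kn; rewrite -nk addn2 prednK // ltnn.
- apply/seteqP; split=> mu /=.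
    move=> [Gmu]; have [neg|//] := G_cases hX hp0 Gmu.
    by rewrite card_neg_all // => /esym/pred_neq.
  move=> [j [mj0 neg dom]]; split; last exact: (card_neg_all_but_one mj0 neg).
  exact: (G_of_dominant X hp0 hp1 mj0 neg dom).
- apply/seteqP; split=> mu /=.
    move=> [Gmu]; have [//|[j [mj0 neg _]]] := G_cases hX hp0 Gmu.
    by rewrite (card_neg_all_but_one mj0 neg) => /pred_neq.
  by move=> neg; split; [exact: G_of_neg|exact: card_neg_all].
- apply/seteqP; split=> mu /=; last by case=> -[].
  move=> Gmu; have [neg|[j [mj0 neg _]]] := G_cases hX hp0 Gmu.
    by right; split=> //; exact: card_neg_all.
  by left; split=> //; exact: (card_neg_all_but_one mj0 neg).
Qed.
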